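(* Let $(X,r)$ be a solution with $X$ finite and let $n:=|X|$. Then the Dehornoy's class of $(X,r)$ is bounded above by $24^{\frac{n-1}{3}}$.
   Context: A solution is a pair $(X,r)$ with $X$ a non-empty set and $r:X\times X\to X\times X$, $r(x,y)=(\sigma_x(y),\tau_y(x))$, such that $(r\times \mathrm{id})(\mathrm{id}\times r)(r\times \mathrm{id})=(\mathrm{id}\times r)(r\times \mathrm{id})(\mathrm{id}\times r)$ on $X^3$, $r^2=\mathrm{id}$ (involutive), and all maps $\sigma_x,\tau_y:X\to X$ are bijections (non-degenerate). Dehornoy's class: set $x\cdot y=\sigma_x^{-1}(y)$ and define $\Omega_m:X^m\to X$ by $\Omega_1(x_1)=x_1$ and $\Omega_m(x_1,\dots,x_m)=\Omega_{m-1}(x_1,\dots,x_{m-1})\cdot\Omega_{m-1}(x_1,\dots,x_{m-2},x_m)$ for $m>1$. The Dehornoy's class of $(X,r)$ is the minimal positive integer $d$ such that $\Omega_{d+1}(x,x,\dots,x,y)=y$ for all $x,y\in X$. *)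

(* Defs.v *)
From HB Require Import structures.
From mathcomp Require Import all_boot all_order all_algebra.

Set Implicit Arguments.
Unset Strict Implicit.
Unset Printing Implicit Defensive.

Section Solution.
Variables (X : Type) (r : X * X -> X * X).

Definition r_id (t : X * X * X) : X * X * X :=
  let: (x, y, z) := t in ((r (x, y)).1, (r (x, y)).2, z).

Definition id_r (t : X * X * X) : X * X * X :=
  let: (x, y, z) := t in (x, (r (y, z)).1, (r (y, z)).2).

Definition yang_baxter : Prop :=
  forall t, r_id (id_r (r_id t)) = id_r (r_id (id_r t)).

End Solution.

(* r (x, y) = (sigma_x y, tau_y x) *)
Record solution (X : Type) := Solution {
  rmap : X * X -> X * X;
  sigma (x y : X) : X := (rmap (x, y)).1;
  tau (y x : X) : X := (rmap (x, y)).2;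
  sol_nonempty : inhabited X;
  sol_yang_baxter : yang_baxter rmap;
  sol_involutive : involutive rmap;
  sol_sigma_bij : forall x, bijective (sigma x);
  sol_tau_bij : forall y, bijective (tau y)
}.

Section Dehornoy.
Variables (X : finType) (S : solution X).

(* x . y = sigma_x^-1 (y) *)
Definition dot (x y : X) : X := invF (bij_inj (sol_sigma_bij S x)) y.

(* The arity is shifted: Omega at index m has m.+1 arguments and is the map
   usually written Omega_(m+1).  Precomposing with [lift i] drops the i-th
   argument, so the two recursive calls drop the last argument and the last but
   one respectively. *)
Fixpoint Omega (m : nat) : ('I_m.+1 -> X) -> X :=
  match m with
  | 0 => fun x => x ord0
  | k.+1 => fun x : 'I_k.+2 -> X =>
      dot (@Omega k (fun i => x (lift ord_max i)))
          (@Omega k (fun i => x (lift (inord k) i)))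
  end.

(* Omega_(d+1) (x, ..., x, y) = y for all x, y *)
Definition dehornoy_period (d : nat) : Prop :=
  forall x y : X, @Omega d (fun i => if i == ord_max then y else x) = y.

Definition is_dehornoy_class (d : nat) : Prop :=
  [/\ 0 < d, dehornoy_period d &
      forall e, 0 < e -> dehornoy_period e -> d <= e].

End Dehornoy.

(* Main.v *)
Require Import Defs.
From HB Require Import structures.
From mathcomp Require Import all_boot all_order all_algebra.
From mathcomp Require Import all_fingroup all_solvable all_field all_character.
From mathcomp Require Import zify.
From mathcomp Require Import reals exp.

(** Let [u x] be the permutation [y |-> x . y] of [X], let [G] be the group
    generated by all the [u x], and let [n = #|X|].  The class is at most [#|G|],
    and [#|G| ^ 3 <= 24 ^ (n - 1)], because [G] is solvable.

    The class and [G] are related by a second, commutative, group law on [G].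
    For [x] in [X], the map [t_x : g |-> g * u (g x)] is a permutation of [G].
    The braid equation turns into [u x * u (u x y) = u y * u (u y x)], which
    says that the [t_x] commute; since the orbit of [1] under the abelian group
    [A] that they generate is the whole of [G], the group [A] is regular on [G]
    and [a |-> a 1] is a bijection from [A] to [G].  Unfolding the recursion for
    [Omega] gives [Omega_(m+1) (x, ..., x, y) = (t_x ^ m 1) y]
    ([Omega_shift]), so [#|A| = #|G|] is a period.

    Left multiplication by [h] in [G] conjugates [t_(h x)] to [t_x], hence
    normalises [A], so the bijection [A -> G] is a 1-cocycle and maps
    characteristic subgroups of [A] to subgroups of [G].  Thus [G] has a
    subgroup of index the [p]-part of [#|G|] for each prime [p].  If [G] has at
    most two prime divisors it is solvable by Burnside's theorem; otherwise, by
    induction, it has three solvable subgroups of pairwise coprime indices, and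
    a theorem of Wielandt ([solvable_three_coprime_index]) applies.

    The bound on the order is Dixon's theorem for solvable permutation groups
    ([index_astab_solvable]).  Invariant partitions reduce it, by induction on
    the degree, to primitive groups.  In a primitive solvable group, a minimal
    normal subgroup [N] is elementary abelian and complements a point
    stabiliser, which acts faithfully on it; so the degree is a prime power
    [p ^ k] and the order is at most [p ^ k * #|GL_k(p)|].  That quantity obeys
    the bound, with equality for the symmetric group of degree [4]. *)

Set Implicit Arguments.
Unset Strict Implicit.
Unset Printing Implicit Defensive.

Import Order.TTheory GRing.Theory Num.Theory.

Local Open Scope group_scope.

(** * Solvability from subgroups of coprime index *)

(** As [p] does not divide the index of [K], some conjugate [N :^ x] lies in
    [K]; coprimality gives [G = H * K], and since [H] normalises [N] every
    conjugate of [N] is a conjugate under [K], so they all lie in [K]. *)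
Lemma sub_gcore_coprime_index (gT : finGroupType) (p : nat)
    (G H K N : {group gT}) :
    H \subset G -> K \subset G -> coprime #|G : H| #|G : K| ->
    N <| H -> p.-group N -> p^'.-nat #|G : K| ->
  N \subset gcore K G.
Proof.
move=> sHG sKG co /andP[sNH nNH] pN p'GK.
have defG : H * K = G by apply: coprime_index_mulG.
have [P sylP] := Sylow_exists p K.
have sylPG : p.-Sylow(G) P.
  have [sPK pP _] := and3P sylP.
  rewrite pHallE (subset_trans sPK sKG) (card_Hall sylP).
  rewrite -(Lagrange sKG) partnM // [(#|G : K|`_p)%N]part_p'nat // muln1.
  by rewrite eqxx.
have [x Gx sNP] := Sylow_Jsub sylPG (subset_trans sNH sHG) pN.
have conjN h k : h \in H -> N :^ (h * k) = N :^ k.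
  by move=> Hh; rewrite conjsgM (normsP nNH).
have sNK : N \subset K.
  have := Gx; rewrite -defG => /mulsgP[h k Hh Kk defx].
  rewrite -(conjSg _ _ k) (conjGid Kk) -(conjN h) // -defx.
  exact: subset_trans sNP (pHall_sub sylP).
apply/bigcapsP => y Gy; rewrite -sub_conjgV.
have := groupVr Gy; rewrite -defG => /mulsgP[h k Hh Kk ->].
by rewrite conjN // -(conjGid Kk) conjSg.
Qed.

(** Wielandt's theorem.  A minimal normal subgroup [N] of [H1] is a [p]-group,
    and [p] cannot divide both the index of [H2] and that of [H3].  If it does
    not divide the index of [K], the core of [K] in [G] contains [N]: it is a
    nontrivial solvable normal subgroup, and the quotient by it inherits the
    hypotheses. *)
Lemma solvable_three_coprime_index (gT : finGroupType)
    (G H1 H2 H3 : {group gT}) :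
    H1 \subset G -> H2 \subset G -> H3 \subset G ->
    solvable H1 -> solvable H2 -> solvable H3 ->
    coprime #|G : H1| #|G : H2| -> coprime #|G : H1| #|G : H3| ->
    coprime #|G : H2| #|G : H3| ->
  solvable G.
Proof.
have [n] := ubnP #|G|; elim: n => // n IHn in gT G H1 H2 H3 *.
move=> /ltnSE leGn s1 s2 s3 sol1 sol2 sol3 co12 co13 co23.
have [H1_1 | ntH1] := eqVneq H1 1%G.
  suff /eqP : #|G : H2| == 1%N by move/index1g => <-.
  rewrite -dvdn1 -(eqP co12) dvdn_gcd dvdnn andbT H1_1 indexg1.
  exact: dvdn_indexg.
have [N minN sNH1] := minnormal_exists ntH1 (normG _).
have [nNH1 ntN abN] := minnormal_solvable minN sNH1 sol1.
have nsN : N <| H1 by rewrite /normal sNH1 nNH1.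
set p := pdiv #|N|; have pN : p.-group N by apply: abelem_pgroup abN.
have p_pr : prime p by rewrite pdiv_prime // cardG_gt1.
suff [L [nsL ntL solL]] :
    exists L : {group gT}, [/\ L <| G, L :!=: 1 & solvable L].
  rewrite (series_sol nsL) solL /=.
  have nL (Q : {set gT}) : Q \subset G -> Q \subset 'N(L).
    by move=> sQG; apply: subset_trans sQG (normal_norm nsL).
  have co_quo (P Q : {group gT}) :
      coprime #|G : P| #|G : Q| -> coprime #|G / L : P / L| #|G / L : Q / L|.
    move=> coPQ.
    have idx (Q' : {group gT}) : #|G / L : Q' / L| %| #|G : Q'|.
      by rewrite index_quotient // nL ?subsetIl.
    exact: coprime_dvdl (idx P) (coprime_dvdr (idx Q) coPQ).
  apply: (IHn _ _ (H1 / L)%G (H2 / L)%G (H3 / L)%G);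
    rewrite ?quotientS ?quotient_sol ?co_quo //.
  by apply: leq_trans leGn; rewrite ltn_quotient // normal_sub.
have suffK (K : {group gT}) : K \subset G -> solvable K ->
    coprime #|G : H1| #|G : K| -> p^'.-nat #|G : K| ->
    exists L : {group gT}, [/\ L <| G, L :!=: 1 & solvable L].
  move=> sKG solK coK p'K.
  have sN := sub_gcore_coprime_index s1 sKG coK nsN pN p'K.
  exists [group of gcore K G]; split; first exact: gcore_normal.
    by apply: contraNneq ntN => /= core1; rewrite -subG1 -core1.
  exact: solvableS (gcore_sub _ _) solK.
have [p'2 | ] := boolP (p^'.-nat #|G : H2|); first exact: suffK p'2.
rewrite p'natE // negbK => p2.
apply: (suffK H3) => //; rewrite p'natE //.
apply/negP=> p3; have := prime_gt1 p_pr.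
by rewrite ltnNge dvdn_leq // -(eqP co23) dvdn_gcd p2.
Qed.

(** The cocycle condition is stated through characteristic subgroups: this is
    what remains of [f a * f b = f (a * b ^ alpha)], with [alpha] an automorphism
    of [A] that depends on [a], once [alpha] is forgotten.  The image of a
    characteristic subgroup [H] is then a group, of order [#|H|].  The induction
    on [#|H|] removes one prime at a time: the image of ['O_p^'(H)] has index
    the [p]-part of [#|H|], and three distinct primes give three solvable
    subgroups of pairwise coprime indices. *)
Lemma solvable_bijective_cocycle (gT aT : finGroupType) (G : {group gT})
    (A : {group aT}) (f : aT -> gT) :
    abelian A -> {in A &, injective f} -> f @: A = G ->
    (forall H : {group aT}, H \char A ->
      {in A & H, forall a b, exists2 c, c \in H & f a * f b = f (a * c)}) ->
  solvable G.
Proof.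
move=> abA injf fA fM.
have f1 : f 1 = 1.
  have [c /set1P-> /eqP] := fM 1%G (char1 _) 1 1 (group1 _) (group1 _).
  by rewrite mulg1 eq_mulgV1 mulgK => /eqP.
have f_group (H : {group aT}) : H \char A -> group_set (f @: H).
  move=> chH; have sHA := char_sub chH.
  apply/group_setP; split; first by rewrite -f1 imset_f.
  move=> _ _ /imsetP[a Ha ->] /imsetP[b Hb ->].
  have [c Hc ->] := fM H chH a b (subsetP sHA _ Ha) Hb.
  by rewrite imset_f // groupM.
suff sol (H : {group aT}) (chH : H \char A) : solvable (group (f_group H chH)).
  by have := sol A (char_refl A); rewrite /= fA.
have [n] := ubnP #|H|; elim: n => // n IHn in H chH *; move=> /ltnSE leHn.
have cardf (K : {group aT}) : K \subset A -> #|f @: K| = #|K|.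
  by move=> sKA; apply: card_in_imset; apply: sub_in2 injf; apply/subsetP.
have sHA := char_sub chH.
have [le2 | gt2] := leqP (size (primes #|H|)) 2.
  by apply: Burnside_p_a_q_b; rewrite cardf.
have chO (p : nat) : 'O_p^'(H) \char A by apply: char_trans chH; apply: pcore_char.
have fO (p : nat) : f @: 'O_p^'(H) \subset f @: H by apply/imsetS/pcore_sub.
have idx (p : nat) : #|f @: H : group (f_group _ (chO p))| = (#|H|`_p)%N.
  rewrite -(divgS (G := group (f_group _ chH))) //= !cardf ?char_sub //.
  have nilH : nilpotent H by apply/abelian_nil/(abelianS sHA).
  rewrite (card_Hall (nilpotent_pcore_Hall _ nilH)) -[X in X %/ _](partnC p) //.
  by rewrite mulnK.
  exact: chO.
have solO (q : nat) : q \in primes #|H| -> solvable (group (f_group _ (chO q))).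
  rewrite mem_primes => /and3P[q_pr _ qH].
  apply: IHn; apply: leq_trans leHn; rewrite ltnNge.
  apply: contraL qH => leO.
  rewrite -p'natE //; suff <- : 'O_q^'(H) = H by apply: pcore_pgroup.
  by apply/eqP; rewrite eqEcard pcore_sub.
have co (p q : nat) : p != q -> coprime (#|H|`_p)%N (#|H|`_q)%N.
  move=> neq_pq; apply: (@pnat_coprime p); first exact: part_pnat.
  by apply: pi_pnat (part_pnat _ _) _; rewrite !inE eq_sym.
have := primes_uniq #|H|.
case: (primes _) gt2 solO => [|p [|q [|r s]]] //= _ solO /and3P[].
rewrite !inE !negb_or => /and3P[pq pr _] /andP[qr _] _.
apply: (@solvable_three_coprime_index _ (group (f_group H chH)) (group (f_group _ (chO p)))
  (group (f_group _ (chO q))) (group (f_group _ (chO r)))) => //;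
  by rewrite ?idx ?co ?fO // solO // !inE eqxx ?orbT.
Qed.

(** * The order of the affine group of dimension k over F_p *)

(** Passing from [k] to [k + 1] multiplies the left side by [p ^ (6 * (k + 1))]
    and the right side by [24 ^ (p ^ k * (p - 1))], which is larger as soon as
    [3 * (k + 1) <= 2 * p ^ k], because [p <= 2 ^ (p - 1)] and [2 ^ 4 <= 24]. *)
Lemma prime_power_cube_bound (p k : nat) : 1 < p -> 0 < k ->
    5 <= p \/ (p = 3 /\ 2 <= k) \/ (p = 2 /\ 4 <= k) ->
  ((p ^ (k * k.+1)) ^ 3 <= 24 ^ (p ^ k).-1)%N.
Proof.
move=> p_gt1.
have step j : (3 * j.+1 <= 2 * p ^ j)%N ->
    ((p ^ (j * j.+1)) ^ 3 <= 24 ^ (p ^ j).-1)%N ->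
    ((p ^ (j.+1 * j.+2)) ^ 3 <= 24 ^ (p ^ j.+1).-1)%N.
  move=> lej IH.
  have -> : (p ^ (j.+1 * j.+2) = p ^ (j * j.+1) * p ^ (2 * j.+1))%N.
    by rewrite -expnD; congr (_ ^ _)%N; lia.
  have -> : ((p ^ j.+1).-1 = (p ^ j).-1 + p ^ j * p.-1)%N.
    have := expn_gt0 p j; rewrite expnS; nia.
  rewrite expnMn expnD leq_mul // -expnM.
  have lep : (p <= 2 ^ p.-1)%N.
    by rewrite -[X in (X <= _)%N](prednK (ltnW p_gt1)) ltn_expl.
  apply: (@leq_trans ((2 ^ p.-1) ^ (2 * j.+1 * 3))).
    by rewrite leq_exp2r; lia.
  apply: (@leq_trans ((2 ^ 4) ^ (p ^ j * p.-1))); last by rewrite leq_exp2r; nia.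
  rewrite -!expnM leq_exp2l //; nia.
have grow j : (3 * j.+1 <= 2 * p ^ j)%N -> forall i,
    ((p ^ (j * j.+1)) ^ 3 <= 24 ^ (p ^ j).-1)%N ->
    ((p ^ ((j + i) * (j + i).+1)) ^ 3 <= 24 ^ (p ^ (j + i)).-1)%N.
  move=> lej; elim=> [|i IHi] base; first by rewrite addn0.
  rewrite addnS; apply: step (IHi base).
  elim: i {IHi} => [|i IHi]; first by rewrite addn0.
  rewrite addnS expnS; have := expn_gt0 p (j + i); nia.
move=> k_gt0 [p5 | [[p3 k2] | [p2 k4]]].
- rewrite -(subnKC k_gt0); apply: grow; first by rewrite expn1; lia.
  rewrite mul1n expn1 -expnM -(subnKC p5).
  (* From [p] to [p + 1]: [((p + 1) / p) ^ 6 <= (3 / 2) ^ 6 <= 24]. *)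
  elim: (p - 5)%N => [|m IHm].
    rewrite addn0; apply: (@leq_trans ((5 ^ 3) ^ 2)).
      by rewrite -expnM leq_exp2l.
    apply: (@leq_trans ((24 ^ 2) ^ 2)); first by rewrite leq_exp2r.
    by rewrite -expnM leq_exp2l.
  rewrite addnS [X in (_ <= 24 ^ X)%N](_ : _ = (5 + m).-1.+1) //.
  have le32 : ((2 * (5 + m).+1) ^ 6 <= (3 * (5 + m)) ^ 6)%N.
    by rewrite leq_exp2r //; lia.
  rewrite !expnMn in le32; rewrite expnS.
  move: le32 IHm; rewrite (_ : 2 ^ 6 = 64)%N // (_ : 3 ^ 6 = 729)%N //.
  move: (_ ^ 6)%N (_ ^ 6)%N (24 ^ _)%N => x y z; lia.
- rewrite -(subnKC k2) p3; rewrite p3 in grow; apply: grow; first by [].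
  rewrite -!expnM.
  apply: (@leq_trans ((3 ^ 2) ^ 9)); first by rewrite -expnM leq_exp2l.
  apply: (@leq_trans ((9 * 2) ^ 8)); last by rewrite leq_exp2r.
  rewrite expnMn (expnSr _ 8); apply: leq_mul; first by rewrite leq_exp2r.
  exact: (@leq_trans (2 ^ 4)).
- rewrite -(subnKC k4) p2; rewrite p2 in grow; apply: grow; first by [].
  apply: (@leq_trans ((2 ^ 4) ^ 15)); first by rewrite -!expnM leq_exp2l.
  by rewrite leq_exp2r.
Qed.

Lemma card_GL_le (F : finFieldType) (k : nat) : 0 < k ->
  (#|'GL_k[F]| <= #|F| ^ (k * k))%N.
Proof.
move=> k_gt0; rewrite card_GL //.
have le_prod : (\prod_(1 <= i < k.+1) (#|F| ^ i - 1) <= #|F| ^ 'C(k.+1, 2))%N.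
  rewrite -bin2_sum expn_sum big_add1 [in X in (_ <= X)%N]big_nat_recl // expn0 mul1n.
  by apply: leq_prod => i _; apply: leq_subr.
apply: leq_trans (leq_mul (leqnn _) le_prod) _; rewrite -expnD.
rewrite leq_exp2l ?(finNzRing_gt1 F) //; apply: eq_leq.
by elim: k {k_gt0 le_prod} => // k IHk; rewrite !binS !bin1 bin0 in IHk *; lia.
Qed.

(** The estimate [#|'GL_k| <= q ^ (k * k)] is enough except when the order [q]
    and the dimension [k] are [(3, 1)], [(2, 1)], [(2, 2)] or [(2, 3)]; these
    cases need the exact order, [(2, 2)] being the case of equality. *)
Lemma card_affine_le (F : finFieldType) (k : nat) : prime #|F| -> 0 < k ->
  ((#|F| ^ k * #|'GL_k[F]|) ^ 3 <= 24 ^ (#|F| ^ k).-1)%N.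
Proof.
move=> p_pr k_gt0; have p_gt1 := prime_gt1 p_pr.
have [p5 | [p3 | p2]] : 5 <= #|F| \/ #|F| = 3 \/ #|F| = 2.
  by case: #|F| p_pr p_gt1 => [|[|[|[|[|n]]]]] //; auto.
- apply: leq_trans (prime_power_cube_bound p_gt1 k_gt0 (or_introl p5)).
  by rewrite leq_exp2r // mulnS expnD leq_mul // card_GL_le.
- have [k2 | ] := leqP 2 k.
    apply: leq_trans (prime_power_cube_bound p_gt1 k_gt0 _); last by auto.
    by rewrite leq_exp2r // mulnS expnD leq_mul // card_GL_le.
  by case: k k_gt0 => [|[|]] // _ _; rewrite card_GL_1 p3.
have [k4 | ] := leqP 4 k.
  apply: leq_trans (prime_power_cube_bound p_gt1 k_gt0 _); last by auto.
  by rewrite leq_exp2r // mulnS expnD leq_mul // card_GL_le.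
case: k k_gt0 => [|[|[|[|]]]] // _ _; rewrite ?card_GL_1 ?card_GL_2 p2 //.
(* [q = 2] and [k = 3]: after division by [8 ^ 6 * 3 ^ 3], the claim
   [(8 ^ 2 * 7 * 3) ^ 3 <= 24 ^ 7] reads [7 ^ 3 <= 8 * 3 ^ 4]. *)
have -> : (2 ^ 3 * #|'GL_3[F]| = 8 ^ 2 * 7 * 3)%N.
  rewrite (card_GL F (isT : 0 < 3)) p2.
  by do 3!(rewrite big_ltn; last by []); rewrite big_geq.
have -> : (24 ^ (2 ^ 3).-1 = 8 ^ 6 * (8 * 3 ^ 4) * 3 ^ 3)%N.
  have -> : (2 ^ 3).-1 = 7 by [].
  have -> : (24 = 8 * 3)%N by [].
  have e37 : (3 ^ 7 = 3 ^ 4 * 3 ^ 3)%N by rewrite -expnD.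
  rewrite expnMn e37 expnSr.
  by move: (8 ^ 6)%N (3 ^ 4)%N (3 ^ 3)%N 8 => a b c e; rewrite !mulnA.
rewrite (expnMn _ 3) (expnMn _ 7) -expnM leq_mul2r; apply/orP; right.
by rewrite leq_mul2l; apply/orP; right.
Qed.

(** * Orders of solvable permutation groups *)

(** This is the primitive case, [M] being a point stabiliser.  For a minimal
    normal subgroup [N], both [N :&: M] and ['C_M(N)] are normalised by [M] and
    centralised by [N], hence normal in [G = N * M], hence trivial.  So [N] has
    order [#|G : M|] and [M] embeds into the linear group of [N]. *)
Lemma card_core_free_maximal (gT : finGroupType) (G M : {group gT}) :
    solvable G -> maximal M G ->
    (forall L : {group gT}, L <| G -> L \subset M -> L :=: 1) ->
  (#|G| ^ 3 <= 24 ^ #|G : M|.-1)%N.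
Proof.
move=> solG maxM core1.
have [/andP[sMG _] maxMG] := maxgroupP maxM.
have ntG : G :!=: 1.
  apply: contraTneq (maxgroupp maxM) => ->.
  by rewrite properE sub1G andbF.
have [N minN sNG] := minnormal_exists ntG (normG G).
have [nNG ntN abN] := minnormal_solvable minN sNG solG.
have nsN : N <| G by rewrite /normal sNG nNG.
have abelN := abelem_abelian abN.
have nMN : M \subset 'N(N) := subset_trans sMG nNG.
have defG : N * M = G.
  rewrite -norm_joinEr //; apply/eqP; rewrite eqEproper join_subG sNG sMG /=.
  apply/negP => ltG; have := maxMG _ ltG (joing_subr _ _) => /= defM.
  by case/eqP: ntN; apply: core1 nsN _; rewrite -defM joing_subl.
have normal_core (D : {group gT}) :
    D \subset M -> M \subset 'N(D) -> N \subset 'N(D) -> D :=: 1.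
  move=> sDM nDM nDN; apply: core1 => //.
  by rewrite /normal (subset_trans sDM sMG) -defG mul_subG.
have tiNM : N :&: M = 1.
  apply: normal_core => /=; first exact: subsetIr.
    by rewrite normsI ?normG.
  by rewrite cents_norm // (subset_trans abelN) ?centS ?subsetIl.
have cM1 : 'C_M(N) = 1.
  apply: normal_core => /=; first exact: subsetIl.
    by rewrite normsI ?normG ?norms_cent.
  by rewrite cents_norm // centsC subsetIr.
have cardG : #|G| = (#|N| * #|M|)%N by rewrite -defG TI_cardMg.
have -> : #|G : M| = #|N| by rewrite -divgS // cardG mulnK.
have [p_pr _ _] := pgroup_pdiv (abelem_pgroup abN) ntN.
set p := pdiv #|N| in abN p_pr.
pose rM := abelem_repr abN ntN nMN.
have leM : #|M| <= #|'GL_('dim N)['F_p]|.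
  have injr : 'injm (reprGLm rM) by rewrite ker_reprGLm rker_abelem cM1.
  by rewrite -(card_injm injr (subxx M)) subset_leq_card ?subsetT.
have cardN : #|N| = (#|'F_p| ^ 'dim N)%N.
  by rewrite -(card_abelem_rV abN ntN) card_mx mul1n.
have := @card_affine_le 'F_p ('dim N); rewrite card_Fp // => /(_ p_pr isT).
rewrite {1}card_Fp // in cardN.
rewrite -cardN => le24; apply: leq_trans le24.
by rewrite leq_exp2r // cardG leq_mul.
Qed.

Lemma card_maximal_core_quotient (gT : finGroupType) (G M C : {group gT}) :
    solvable G -> maximal_eq M G -> C <| G -> C \subset M ->
    (forall L : {group gT}, L <| G -> L \subset M -> L \subset C) ->
  (#|G : C| ^ 3 <= 24 ^ #|G : M|.-1)%N.
Proof.
move=> solG /orP[/eqP defM | maxM] nsC sCM coreC.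
  rewrite defM indexgg; suff /eqP -> : #|G : C| == 1%N by [].
  by rewrite indexg_eq1 coreC ?normal_refl ?defM.
have nCG := normal_norm nsC.
have sMG : M \subset G := proper_sub (maxgroupp maxM).
rewrite -card_quotient // -(index_quotient_eq (H := C)) //; last first.
  by rewrite (subset_trans (subsetIr _ _)).
apply: card_core_free_maximal; first exact: quotient_sol.
  by rewrite quotient_maximal // (normalS sCM sMG).
move=> L nsL sLM; have [K defL sCK nsK] := inv_quotientN nsC nsL.
apply/trivgP; rewrite defL quotient_sub1 ?(subset_trans (normal_sub nsK) nCG) //.
apply: (coreC _ nsK); rewrite -(quotientSGK (A := K) _ sCM) -?defL //.
exact: subset_trans (normal_sub nsK) nCG.
Qed.

Lemma index_setI_le (gT : finGroupType) (G A B : {group gT}) :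
  (#|G : A :&: B| <= #|G : A| * #|G : B|)%N.
Proof.
rewrite -(indexgI G (A :&: B)) -(indexgI G A) setIA.
rewrite -(Lagrange_index (subsetIl G A) (subsetIl (G :&: A) B)).
rewrite leq_mul2l (indexgI (G :&: A)%G); apply/orP; right.
exact/subset_leq_card/imsetS/subsetIl.
Qed.

Section ActionOnBlocks.
Variables (gT : finGroupType) (sT : finType) (to : {action gT &-> sT}).

Lemma index_astab_bigcup (K : {group gT}) (r : seq {set sT}) :
    (forall B, B \in r -> #|K : 'C(B | to)| ^ 3 <= 24 ^ #|B|.-1)%N ->
  (#|K : 'C(\bigcup_(B <- r) B | to)| ^ 3 <= 24 ^ (\sum_(B <- r) #|B|.-1))%N.
Proof.
elim: r => [|B r IHr] le_r.
  rewrite !big_nil; suff /eqP-> : #|K : 'C(set0 | to)| == 1%N by [].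
  by rewrite indexg_eq1; apply/subsetP=> x _; apply/astabP=> y; rewrite inE.
rewrite !big_cons astabU expnD.
apply: (@leq_trans
  ((#|K : 'C(B | to)| * #|K : 'C(\bigcup_(B <- r) B | to)|) ^ 3)).
  by rewrite leq_exp2r // index_setI_le.
rewrite expnMn leq_mul ?le_r ?mem_head // IHr // => B' rB'.
by rewrite le_r // inE rB' orbT.
Qed.

(** The bound is multiplicative along an invariant partition [Q]: the kernel of
    the action on [Q] acts on each block, and the exponents add up, as
    [(#|Q| - 1) + \sum_(B in Q) (#|B| - 1) = #|S| - 1]. *)
Lemma index_astab_blocks (G : {group gT}) (S : {set sT}) (Q : {set {set sT}}) :
    partition Q S ->
    (#|G : 'C(Q | to^*)| ^ 3 <= 24 ^ #|Q|.-1)%N ->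
    (forall (B : {set sT}) (K : {group gT}), B \in Q -> K \subset G ->
       K \subset 'N(B | to) -> #|K : 'C(B | to)| ^ 3 <= 24 ^ #|B|.-1)%N ->
  (#|G : 'C(S | to)| ^ 3 <= 24 ^ #|S|.-1)%N.
Proof.
move=> partQ leQ leB; have /and3P[/eqP defS tiQ ntQ] := partQ.
pose K := 'C_G(Q | to^*)%G.
have leK : (#|K : 'C(S | to)| ^ 3 <= 24 ^ (\sum_(B in Q) #|B|.-1))%N.
  rewrite -defS /cover -[\bigcup_(B in Q) B]big_enum -[X in (24 ^ X)%N]big_enum.
  apply: index_astab_bigcup => B; rewrite mem_enum => QB.
  apply: leB => //; first exact: subsetIl.
  apply/subsetP=> x /setIP[_ cQx]; rewrite -astab1_set.
  by apply: subsetP cQx; apply: astabS; rewrite sub1set.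
have sumQ : (#|Q| + \sum_(B in Q) #|B|.-1 = #|S|)%N.
  rewrite (card_partition partQ) -sum1_card -big_split /=.
  apply: eq_bigr => B QB; rewrite add1n prednK // card_gt0.
  by apply: contraNneq ntQ => <-.
have le_idx : (#|G : 'C(S | to)| <= #|G : 'C(Q | to^*)| * #|K : 'C(S | to)|)%N.
  rewrite -(indexgI G 'C(Q | _)) -(indexgI K) Lagrange_index ?subsetIl //.
  rewrite dvdn_leq ?indexg_gt0 // indexgS //.
  exact: subsetIr.
rewrite -(leq_exp2r _ _ (isT : 0 < 3)) in le_idx.
apply: leq_trans le_idx _; rewrite expnMn; apply: leq_trans (leq_mul leQ leK) _.
rewrite -expnD leq_exp2l // -sumQ.
case: (posnP #|Q|) => [/eqP | Q_gt0]; last by rewrite -(prednK Q_gt0) addSn.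
by rewrite cards_eq0 => /eqP->; rewrite big_set0 cards0.
Qed.

End ActionOnBlocks.

(** Dixon's bound.  The index of the pointwise stabiliser is the order of the
    group induced on [S]; in this form the bound passes to orbits and blocks
    without replacing the group. *)
Theorem index_astab_solvable (gT : finGroupType) (sT : finType)
    (to : {action gT &-> sT}) (G : {group gT}) (S : {set sT}) :
    solvable G -> [acts G, on S | to] ->
  (#|G : 'C(S | to)| ^ 3 <= 24 ^ #|S|.-1)%N.
Proof.
have [n] := ubnP #|S|; elim: n => // n IHn in gT sT to G S *.
move=> /ltnSE leSn solG actS.
have IHB (B : {set sT}) (K : {group gT}) : B \proper S -> K \subset G ->
    K \subset 'N(B | to) -> (#|K : 'C(B | to)| ^ 3 <= 24 ^ #|B|.-1)%N.
  move=> ltBS sKG actB; apply: IHn => //; last exact: solvableS solG.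
  exact: leq_trans (proper_card ltBS) leSn.
have [trG | ntrG] := boolP [transitive G, on S | to]; last first.
  (* An intransitive group acts trivially on the partition into orbits. *)
  apply: (index_astab_blocks (orbit_partition actS)).
    suff /eqP-> : #|G : 'C(orbit to G @: S | to^*)| == 1%N.
      by rewrite exp1n expn_gt0.
    rewrite indexg_eq1; apply/subsetP=> x Gx; apply/astabP=> _ /imsetP[s Ss ->].
    apply/astab1P; rewrite astab1_set; apply: subsetP Gx.
    by apply: acts_orbit; rewrite subsetT.
  move=> _ K /imsetP[s Ss ->] sKG actK; apply: IHB => //.
  rewrite properEneq acts_sub_orbit // Ss andbT.
  by apply: contraNneq ntrG => <-; apply/imsetP; exists s; rewrite ?orbit_refl.
have [s Ss defS] := imsetP trG.
have [primG | ] := boolP [primitive G, on S | to]; last first.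
  rewrite /primitive trG negbK => /existsP[Q /and3P[partQ actQ /andP[gt1 ltQS]]].
  apply: (index_astab_blocks partQ).
    by apply: IHn => //; apply: leq_trans leSn.
  (* As [1 < #|Q|], no block is the whole of [S]. *)
  have /and3P[/eqP defSQ tiQ ntQ] := partQ.
  move=> B K QB sKG actB; apply: IHB => //.
  have sBS (B' : {set sT}) : B' \in Q -> B' \subset S.
    by move=> QB'; rewrite -defSQ; apply: bigcup_max QB' _.
  rewrite properEneq sBS // andbT; apply: contraTneq gt1 => defB.
  rewrite -leqNgt -(cards1 B) subset_leq_card //; apply/subsetP=> B' QB'.
  rewrite inE; apply: contraNT ntQ => neqB.
  suff <- : B' = set0 by [].
  have := trivIsetP tiQ B' B QB' QB neqB.
  by rewrite defB -setI_eq0 (setIidPl (sBS _ QB')) => /eqP.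
rewrite (trans_prim_astab Ss trG) in primG.
have cS x : x \in S -> 'C(S | to) \subset 'C[x | to].
  by move=> Sx; apply: astabS; rewrite sub1set.
have cardS : #|S| = #|G : 'C_G[s | to]|.
  by rewrite -card_orbit (atransP trG s Ss).
rewrite cardS -indexgI.
apply: card_maximal_core_quotient => //.
- rewrite /normal subsetIl /=; apply: normsI (normG _) _.
  exact: subset_trans actS (astab_norm _ _).
- by rewrite setIS // cS.
move=> L nsL sLs; rewrite subsetI normal_sub //.
apply/subsetP=> x Lx; apply/astabP=> y Sy.
have [g Gg ->] := atransP2 trG Ss Sy.
rewrite -actM conjgCV actM (_ : to s _ = s) //.
have /setIP[_] : x ^ g^-1 \in 'C_G[s | to].
  by apply: (subsetP sLs); rewrite memJ_norm // groupV (subsetP (normal_norm nsL)).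
by move/astab1P.
Qed.

(** * The permutation group of a solution and its commutative group law *)

Section PermutationGroup.
Variables (X : finType) (S : solution X).

Definition dot_perm (x : X) : {perm X} :=
  (perm (bij_inj (sol_sigma_bij S x)))^-1.
Local Notation u := dot_perm.

Lemma dot_permE x y : u x y = dot S x y.
Proof. by apply: (canLR (permK _)); rewrite permE /dot f_invF. Qed.

Lemma sigmaK x : cancel (sigma S x) (u x).
Proof. by move=> y; rewrite dot_permE /dot invF_f. Qed.

Lemma dot_permK x : cancel (u x) (sigma S x).
Proof. by move=> y; rewrite dot_permE /dot f_invF. Qed.

Lemma tau_dot_perm x y : tau S (u x y) x = u y x.
Proof.
apply: (canRL (sigmaK _)).
have := sol_involutive S (x, u x y); rewrite [rmap S (x, _)]surjective_pairing.
move=> /(congr1 fst) /=; rewrite -/(sigma S _ _) -/(sigma S _ _) -/(tau S _ _).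
by rewrite dot_permK.
Qed.

Lemma sigma_braid x y z :
  sigma S (sigma S x y) (sigma S (tau S y x) z) = sigma S x (sigma S y z).
Proof. by have /(congr1 (fun t => t.1.1)) := sol_yang_baxter S (x, y, z). Qed.

(** With [z = u x y] the inverse of the left side is [sigma_x] after [sigma_z].
    By the braid equation this is [sigma_(sigma_x z) = sigma_y] after
    [sigma_(tau_z x)], and [tau_z x = u y x] because [r] is an involution. *)
Lemma cycle_set_identity x y : u x * u (u x y) = u y * u (u y x).
Proof.
apply: invg_inj; rewrite !invMg; apply/permP=> z; rewrite !permM.
have sE a b : (u a)^-1 b = sigma S a b by rewrite invgK permE.
rewrite !sE -[RHS]sigma_braid tau_dot_perm.
by rewrite dot_permK.
Qed.

(** The value [y = u x x] determines [x], because [tau_y x = y]. *)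
Lemma diag_inj : injective (fun x => u x x).
Proof.
move=> x y /= eq_xy; have := tau_dot_perm x x; rewrite eq_xy.
by rewrite -{2}(tau_dot_perm y y) => /(bij_inj (sol_tau_bij S _)).
Qed.

Definition yb_group := <<[set u x | x : X]>>.
Canonical yb_group_group := [group of yb_group].
Local Notation G := yb_group.

Lemma dot_perm_in x : u x \in G.
Proof. by rewrite mem_gen // imset_f. Qed.

(** Outside the group the map is the identity: the shifts are then permutations
    of a type, and the group that they generate acts faithfully on [G]. *)
Definition shift_fun (x : X) (g : {perm X}) : {perm X} :=
  if g \in G then g * u (g x) else g.

Lemma shift_fun_in x g : (shift_fun x g \in G) = (g \in G).
Proof.
by rewrite /shift_fun; case: ifP => // Gg; rewrite groupM ?dot_perm_in.
Qed.

Lemma shift_fun_inj x : injective (shift_fun x).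
Proof.
move=> g h eq_gh; have := congr1 (mem G) eq_gh; rewrite !inE !shift_fun_in.
move: eq_gh; rewrite /shift_fun.
case: ifP => Gg; case: ifP => // Gh eq_gh _.
have eq_x : g x = h x by apply: diag_inj; rewrite -!permM eq_gh.
by move: eq_gh; rewrite eq_x => /mulIg.
Qed.

Definition shift x : {perm {perm X}} := perm (@shift_fun_inj x).

(** The second group law, realised as the group of its own translations. *)
Definition add_group := <<[set shift x | x : X]>>.
Canonical add_group_group := [group of add_group].
Local Notation A := add_group.

Lemma shift_in x : shift x \in A.
Proof. by rewrite mem_gen // imset_f. Qed.

Lemma shiftE x g : g \in G -> shift x g = g * u (g x).
Proof. by move=> Gg; rewrite permE /shift_fun Gg. Qed.

Lemma shift_out x g : g \notin G -> shift x g = g.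
Proof. by move=> G'g; rewrite permE /shift_fun (negPf G'g). Qed.

Lemma add_group_abelian : abelian A.
Proof.
rewrite /abelian {1}/add_group gen_subG; apply/subsetP=> _ /imsetP[x _ ->].
rewrite /= cent_gen; apply/centP=> _ /imsetP[y _ ->].
apply/permP=> g; rewrite !permM.
have [Gg | G'g] := boolP (g \in G); last by rewrite !shift_out.
rewrite !shiftE ?groupM ?dot_perm_in // -!mulgA; congr (_ * _).
by rewrite !permM cycle_set_identity.
Qed.

Definition lmul (h : {perm X}) : {perm {perm X}} := perm (mulgI h).

(** Since [(h * g) x = g (h x)], the shift by [x] after left multiplication by
    [h] is left multiplication by [h] after the shift by [h x]. *)
Lemma shift_conj x h : h \in G -> shift (h x) ^ lmul h = shift x.
Proof.
move=> Gh; rewrite /conjg; apply: (canLR (mulKg _)).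
apply/permP=> g; rewrite !permM ![lmul h _]permE.
have [Gg | G'g] := boolP (g \in G); last by rewrite !shift_out ?groupMl.
by rewrite !shiftE ?groupM // permM mulgA.
Qed.

Lemma lmul_norm h : h \in G -> lmul h \in 'N(A).
Proof.
move=> Gh; rewrite inE /add_group -genJ gen_subG.
apply/subsetP=> _ /imsetP[_ /imsetP[x _ ->] ->].
by rewrite -[x](permKV h) shift_conj // shift_in.
Qed.

Lemma add_group_stable a g : a \in A -> (a g \in G) = (g \in G).
Proof.
move=> Aa; have sAN : A \subset 'N(G | 'P).
  rewrite gen_subG; apply/subsetP=> _ /imsetP[x _ ->].
  by rewrite !inE; apply/subsetP=> h; rewrite !inE /= apermE permE shift_fun_in.
by have /astabsP := subsetP sAN a Aa; apply.
Qed.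

Lemma add_group_out a g : a \in A -> g \notin G -> a g = g.
Proof.
move=> Aa G'g; have sAC : A \subset 'C(~: G | 'P).
  rewrite gen_subG; apply/subsetP=> _ /imsetP[x _ ->].
  by rewrite !inE; apply/subsetP=> h; rewrite !inE /= apermE => /shift_out ->.
by have /astabP := subsetP sAC a Aa; apply; rewrite inE.
Qed.

Definition eval1 (a : {perm {perm X}}) : {perm X} := a 1.

Lemma eval1_in a : a \in A -> eval1 a \in G.
Proof. by move=> Aa; rewrite add_group_stable ?group1. Qed.

(** The left side is [lmul h (b 1)] for [h = a 1]; moving [lmul h] before [b]
    conjugates [b], and [lmul h] takes [1] to [a 1]. *)
Lemma eval1M a b : eval1 a * eval1 b = eval1 (a * b ^ lmul (eval1 a)).
Proof.
have lmulV : (lmul (a 1))^-1 (a 1) = 1.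
  by apply: (canLR (permK _)); rewrite permE mulg1.
by rewrite /eval1 permM conjgE !permM lmulV [lmul _ _]permE.
Qed.

(** The orbit of [1] is a subgroup by [eval1M], and it contains the generators
    [u x = eval1 (shift x)]. *)
Lemma eval1_onto : eval1 @: A = G.
Proof.
apply/eqP; rewrite eqEsubset; apply/andP; split.
  by apply/subsetP=> _ /imsetP[a Aa ->]; apply: eval1_in.
have gA : group_set (eval1 @: A).
  apply/group_setP; split; first by apply/imsetP; exists 1; rewrite /eval1 ?perm1.
  move=> _ _ /imsetP[a Aa ->] /imsetP[b Ab ->]; rewrite eval1M imset_f // groupM //.
  by rewrite memJ_norm // lmul_norm ?eval1_in.
rewrite (gen_subG _ (group gA)); apply/subsetP=> _ /imsetP[x _ ->].
apply/imsetP; exists (shift x); first exact: shift_in.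
by rewrite /eval1 shiftE ?group1 // perm1 mul1g.
Qed.

(** A transitive abelian group is regular. *)
Lemma eval1_inj : {in A &, injective eval1}.
Proof.
move=> a b Aa Ab eq_ab; apply/permP=> g.
have [Gg | G'g] := boolP (g \in G); last by rewrite !add_group_out.
move: Gg; rewrite -eval1_onto => /imsetP[c Ac ->]; rewrite /eval1 -!permM.
have cA d : d \in A -> c * d = d * c.
  by move=> Ad; apply: (centsP add_group_abelian).
by rewrite !cA // !permM; congr (c _).
Qed.

Lemma yb_group_solvable : solvable G.
Proof.
apply: (solvable_bijective_cocycle add_group_abelian eval1_inj eval1_onto).
move=> H chH a b Aa Hb; exists (b ^ lmul (eval1 a)); last exact: eval1M.
rewrite memJ_norm //; apply: (subsetP (char_norms chH)).
exact/lmul_norm/eval1_in.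
Qed.

Lemma eq_Omega m (x y : 'I_m.+1 -> X) : x =1 y -> Omega S x = Omega S y.
Proof.
by elim: m x y => [|m IHm] x y eq_xy /=; rewrite ?eq_xy //; congr dot; apply: IHm.
Qed.

(** By induction the two recursive calls are the values at [x] and at [y] of
    [g = (shift x ^+ m) 1], and [u (g x) (g y)] is the value at [y] of
    [g * u (g x)], which is [shift x g]. *)
Lemma Omega_shift m x y :
  @Omega X S m (fun i => if i == ord_max then y else x) = (shift x ^+ m) 1 y.
Proof.
elim: m y => [|m IHm] y; first by rewrite expg0 !perm1.
rewrite expgSr permM shiftE; last first.
  by rewrite add_group_stable // groupX ?shift_in.
rewrite permM dot_permE /= -!IHm; congr dot; apply: eq_Omega => i.
  by rewrite eq_sym (negPf (neq_lift _ _)) if_same.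
congr (if _ then y else x).
rewrite -!val_eqE /= /bump inordK //.
have := ltn_ord i; rewrite ltnS leq_eqVlt => /orP[/eqP-> | lti].
  by rewrite leqnn add1n !eqxx.
by rewrite leqNgt lti add0n !ltn_eqF // ltnW.
Qed.

Lemma period_yb_group : dehornoy_period S #|G|.
Proof.
move=> x y; rewrite Omega_shift -eval1_onto card_in_imset; last exact: eval1_inj.
by rewrite expg_cardG ?shift_in // !perm1.
Qed.

Lemma card_yb_group : (#|G| ^ 3 <= 24 ^ #|X|.-1)%N.
Proof.
have actT : [acts G, on [set: X] | 'P].
  by apply/subsetP=> g _; rewrite !inE; apply/subsetP=> x; rewrite !inE.
rewrite -cardsT; apply: leq_trans (index_astab_solvable yb_group_solvable actT).
by rewrite -indexgI (trivgP (perm_faithful _)) indexg1.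
Qed.

Lemma dehornoy_class_exists :
  exists2 d, is_dehornoy_class S d & d <= #|G|.
Proof.
pose per d := (0 < d) && [forall x, forall y,
   @Omega X S d (fun i => if i == ord_max then y else x) == y].
have perP d : reflect (0 < d /\ dehornoy_period S d) (per d).
  apply: (iffP andP) => -[-> dP]; split=> //.
    by move=> x y; apply/eqP; move/forallP/(_ x)/forallP/(_ y): dP.
  by apply/forallP=> x; apply/forallP=> y; apply/eqP/dP.
have perG : per #|G|.
  by apply/perP; split; [exact: cardG_gt0 | exact: period_yb_group].
have exG : exists d, per d by exists #|G|.
exists (ex_minn exG); case: ex_minnP => d /perP[d_gt0 dP] minD; last exact: minD.
by split=> // e e_gt0 eP; apply: minD; apply/perP.
Qed.

End PermutationGroup.

(** * The bound *)

Close Scope group_scope.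
Local Open Scope ring_scope.

Lemma le_powR_third (R : realType) (d b m : nat) : (d ^ 3 <= b ^ m)%N ->
  (d%:R : R) <= b%:R `^ (m%:R / 3%:R).
Proof.
move=> le_db; rewrite powRrM powR_mulrn ?ler0n //.
rewrite -[leLHS](@powRr1 R) ?ler0n // -[X in _ `^ X](@divff _ 3%:R) ?pnatr_eq0 //.
rewrite powRrM powR_mulrn ?ler0n //.
apply: ge0_ler_powR; rewrite ?nnegrE ?invr_ge0 ?exprn_ge0 ?ler0n //.
by rewrite -!natrX ler_nat.
Qed.

Theorem proposition5p10 (R : realType) (X : finType) (S : solution X) :
  exists d : nat, is_dehornoy_class S d /\
    (d%:R : R) <= 24%:R `^ ((#|X|%:R - 1) / 3%:R).
Proof.
have [d classd led] := dehornoy_class_exists S; exists d; split=> //.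
have X_gt0 : (0 < #|X|)%N by have [x] := sol_nonempty S; apply/card_gt0P; exists x.
have -> : #|X|%:R - 1 = #|X|.-1%:R :> R by rewrite -subn1 natrB.
apply: le_powR_third; apply: leq_trans (card_yb_group S).
by rewrite leq_exp2r.
Qed.
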